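(* Let $n$ be a positive integer, $T>0$, $A\in\mathbb{R}^{n\times n}$ and $B\in\mathbb{R}^{n\times 1}$. Suppose that the pair $(A,B)$ is controllable and the matrix $A$ is nonsingular. Then the value function $V(\xi)=\min_{u\in\mathcal{U}(\xi)}\|u\|_0$ of the maximum hands-off control problem is continuous on the reachable set $\mathcal{R}$.
   Context: Consider the linear time-invariant system $\dot{x}(t)=Ax(t)+Bu(t)$, with state $x(t)\in\mathbb{R}^n$ and scalar control $u(t)\in\mathbb{R}$, on the time interval $[0,T]$. For a measurable function $u:[0,T]\to\mathbb{R}$ define $\|u\|_\infty=\sup_{t\in[0,T]}|u(t)|$ and $\|u\|_0=m(\mathrm{supp}(u))$, where $\mathrm{supp}(u)$ is the closure of $\{t\in[0,T]:u(t)\neq 0\}$ and $m$ is Lebesgue measure on $\mathbb{R}$. For an initial state $\xi\in\mathbb{R}^n$, the set of admissible controls (those steering $x(0)=\xi$ to $x(T)=0$ with magnitude at most $1$) is $$\mathcal{U}(\xi)=\Bigl\{u\in L^1:\int_0^T e^{-As}Bu(s)\,ds=-\xi,\ \|u\|_\infty\le 1\Bigr\}.$$ The value function is $V(\xi)=\min_{u\in\mathcal{U}(\xi)}\|u\|_0$. The reachable set is $$\mathcal{R}=\Bigl\{\int_0^T e^{-As}Bu(s)\,ds:\|u\|_\infty\le 1\Bigr\}\subset\mathbb{R}^n.$$ *)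

(* Defs.v *)
From HB Require Import structures.
From mathcomp Require Import all_boot all_order all_algebra.
From mathcomp Require Import all_classical all_reals all_analysis.
Set Implicit Arguments.
Unset Strict Implicit.
Unset Printing Implicit Defensive.
Import Order.TTheory GRing.Theory Num.Theory.
Import numFieldNormedType.Exports.
Local Open Scope classical_set_scope.
Local Open Scope ring_scope.

Definition expmx (R : realType) (n : nat) (A : 'M[R]_n) : 'M[R]_n :=
  limn (series (fun k : nat => (k`!%:R)^-1 *: A ^+ k)).

Definition input_integral (R : realType) (n : nat) (A : 'M[R]_n) (B : 'cV[R]_n)
    (t : R) (u : R -> R) : 'cV[R]_n :=
  \col_(i < n) \int[lebesgue_measure]_(s in `[0, t])
                 ((expmx (- (s *: A)) *m B) i 0 * u s).

Definition L1_control (R : realType) (t : R) (u : R -> R) : Prop :=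
  (@lebesgue_measure R).-integrable `[0, t] (EFin \o u).

(* Variation of constants: the value at time t of the solution of
   x' = A x + B u with x(0) = x0. *)
Definition state_at (R : realType) (n : nat) (A : 'M[R]_n) (B : 'cV[R]_n)
    (x0 : 'cV[R]_n) (u : R -> R) (t : R) : 'cV[R]_n :=
  expmx (t *: A) *m (x0 + input_integral A B t u).

(* Complete controllability: any state is steered to any other one in some
   finite time, with no bound on the magnitude of the control. *)
Definition controllable (R : realType) (n : nat) (A : 'M[R]_n) (B : 'cV[R]_n)
    : Prop :=
  forall x0 x1 : 'cV[R]_n, exists (t : R) (u : R -> R),
    [/\ 0 < t, L1_control t u & state_at A B x0 u t = x1].

(* A control is a function on R of which only the values on [0, T] matter; it
   is a genuine function and not a class modulo a.e. equality, since the closed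
   support depends on the representative. The supremum is a true (not an
   essential) one, and lives in \bar R because [sup] of an unbounded real set
   is 0. *)
Definition Linfty_norm (R : realType) (T : R) (u : R -> R) : \bar R :=
  ereal_sup [set `|u t|%:E | t in `[0, T]].

Definition L0_norm (R : realType) (T : R) (u : R -> R) : \bar R :=
  lebesgue_measure (closure [set t : R | t \in `[0, T] /\ u t != 0]).

Definition bounded_control (R : realType) (T : R) (u : R -> R) : Prop :=
  L1_control T u /\ (Linfty_norm T u <= 1)%E.

Definition admissible (R : realType) (n : nat) (A : 'M[R]_n) (B : 'cV[R]_n)
    (T : R) (xi : 'cV[R]_n) : set (R -> R) :=
  [set u | bounded_control T u /\ input_integral A B T u = - xi].

Definition reachable_set (R : realType) (n : nat) (A : 'M[R]_n) (B : 'cV[R]_n)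
    (T : R) : set 'cV[R]_n :=
  [set input_integral A B T u | u in [set u | bounded_control T u]].

(* The infimum is finite as soon as xi has an admissible control, since
   L0_norm T u <= T; outside of the reachable set the value is a dummy one. *)
Definition value_function (R : realType) (n : nat) (A : 'M[R]_n)
    (B : 'cV[R]_n) (T : R) (xi : 'cV[R]_n) : R :=
  fine (ereal_inf [set L0_norm T u | u in admissible A B T xi]).

(* Main.v *)
(* Write f(s) = e^{-sA} B and x = - xi. For a row vector p <> 0 the function
   p f has null level sets, because A is invertible and (A, B) controllable.
   Let h(p) be the integral of |p f| over [0, T], the support function of the
   reachable set.

   If p x < h(p) for all p <> 0, the concave dual function
   p x - int (|p f| - 1)^+ is coercive, hence has a maximiser p. The first order
   condition says that the bang-off-bang control u = sign(p f) 1_{|p f| > 1}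
   steers x, and duality says that it minimises the L1 norm. Its closed support
   lies in {|p f| >= 1}, so that its L0 norm equals its L1 norm. Otherwise
   p x >= h(p) for some p <> 0, and every control steering x has |u| = 1 a.e.
   Since the L0 norm dominates the L1 norm of controls bounded by 1, V is in both
   cases the minimal L1 norm; in particular it is convex on the reachable set.

   In the first case a ball around xi is reachable, and a convex function with
   values in [0, T] on a ball is continuous at its centre. In the second case
   V(xi) = T is maximal, and a control steering a point near x almost maximises
   p, hence has |u| close to 1 outside the set of small measure where |p f| is
   small, so that V is close to T there. *)
Require Import Defs.
From HB Require Import structures.
From mathcomp Require Import all_boot all_order all_algebra.
From mathcomp Require Import all_classical all_reals all_analysis.
From mathcomp Require Import measurable_realfun ring lra.
Set Implicit Arguments.
Unset Strict Implicit.
Unset Printing Implicit Defensive.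
Import Order.TTheory GRing.Theory Num.Theory.
Import numFieldNormedType.Exports.
Local Open Scope classical_set_scope.
Local Open Scope ring_scope.

(** * The matrix exponential *)

Lemma cvg_fin_sum (R : realType) (I : finType) (u : I -> R^nat) (l : I -> R) :
  (forall i, true -> u i @ \oo --> l i) ->
  (fun N => \sum_i u i N) @ \oo --> \sum_i l i.
Proof.
by move=> ul; apply: cvg_big => //; exact: add_continuous.
Qed.

(** Domination by the exponential series at [|K| * |x|]. The constant [C] absorbs the extra factors
    that come with formal derivatives. *)
Lemma is_cvg_pseries_fact (R : realType) (c : R^nat) (C K x : R) :
  (forall k, `|c k| <= C * (K ^+ k / k`!%:R)) -> cvgn (pseries c x).
Proof.
move=> cle; apply: normed_cvg.
have C0 : 0 <= C.
  by have := cle 0; rewrite expr0 fact0 divr1 mulr1; apply: le_trans.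
apply: (@series_le_cvg _ _ (C *: exp_coeff (`|K| * `|x|))) => [k|k|k|].
- exact: normr_ge0.
- by rewrite /exp_coeff/= !fctE mulr_ge0// divr_ge0// exprn_ge0// mulr_ge0.
- rewrite !fctE /exp_coeff/= normrM exprMn mulrAC [X in _ <= X]mulrA normrX.
  apply: ler_wpM2r; first exact: exprn_ge0.
  rewrite (le_trans (cle k))// ler_wpM2l// ler_wpM2r ?invr_ge0//.
  by rewrite -normrX ler_norm.
- by apply: is_cvg_seriesZ; exact: is_cvg_series_exp_coeff.
Qed.

Section expmx_theory.
Variables (R : realType) (n : nat).
Implicit Types (A : 'M[R]_n).

(** Each entry of [expmx (s *: A)] is the scalar power series in [s] with these coefficients, which
    brings the theory of [pseries] to bear. *)
Definition expmx_coeff A (i j : 'I_n) (k : nat) : R :=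
  (k`!%:R)^-1 * (A ^+ k) i j.

Definition mx_norm1 A : R := \sum_i \sum_j `|A i j|.

Lemma expmx_entry_bound A k i j : `|(A ^+ k) i j| <= mx_norm1 A ^+ k.
Proof.
have N0 : 0 <= mx_norm1 A by apply: sumr_ge0 => ? _; apply: sumr_ge0.
elim: k i j => [|k ih] i j.
  by rewrite !expr0 mxE; case: eqP => _; rewrite ?normr1 ?normr0.
rewrite exprS mxE (le_trans (ler_norm_sum _ _ _))//.
have Ai : \sum_l `|A i l| <= mx_norm1 A.
  rewrite /mx_norm1 [leRHS](bigD1 i)//= lerDl.
  by apply: sumr_ge0 => ? _; exact: sumr_ge0.
rewrite exprS (le_trans _ (ler_wpM2r _ Ai)) ?exprn_ge0// mulr_suml.
by apply: ler_sum => l _; rewrite normrM ler_wpM2l.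
Qed.

Lemma expmx_coeff_bound A i j k :
  `|expmx_coeff A i j k| <= 1 * (mx_norm1 A ^+ k / k`!%:R).
Proof.
rewrite /expmx_coeff normrM mul1r mulrC [X in _ * X <= _]ger0_norm ?invr_ge0//.
by apply: ler_wpM2r; rewrite ?invr_ge0 ?expmx_entry_bound.
Qed.

(** Formal differentiation raises the power of [A] by one. [pseries_snd_diffs] asks for convergence
    of the series and of its first two formal derivatives. *)
Lemma pseries_diffs_expmx_coeff A i j k :
  pseries_diffs (expmx_coeff A i j) k = (k`!%:R)^-1 * (A ^+ k.+1) i j.
Proof.
rewrite /pseries_diffs /expmx_coeff factS natrM invfM !mulrA divff ?mul1r//.
Qed.

Lemma pseries_diffs2_expmx_coeff A i j k :
  pseries_diffs (pseries_diffs (expmx_coeff A i j)) k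
  = (k`!%:R)^-1 * (A ^+ k.+2) i j.
Proof.
rewrite {1}/pseries_diffs pseries_diffs_expmx_coeff factS natrM invfM !mulrA.
by rewrite divff ?mul1r.
Qed.

Lemma is_cvg_expmx_coeff A i j x : cvgn (pseries (expmx_coeff A i j) x).
Proof. exact/is_cvg_pseries_fact/expmx_coeff_bound. Qed.

Lemma is_cvg_diffs_expmx_coeff A i j x :
  cvgn (pseries (pseries_diffs (expmx_coeff A i j)) x).
Proof.
apply: (@is_cvg_pseries_fact _ _ (mx_norm1 A) (mx_norm1 A)) => k.
rewrite pseries_diffs_expmx_coeff normrM mulrA -exprS mulrC.
rewrite [X in _ * X <= _]ger0_norm ?invr_ge0//.
by apply: ler_wpM2r; rewrite ?invr_ge0 ?expmx_entry_bound.
Qed.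

Lemma is_cvg_diffs2_expmx_coeff A i j x :
  cvgn (pseries (pseries_diffs (pseries_diffs (expmx_coeff A i j))) x).
Proof.
apply: (@is_cvg_pseries_fact _ _ (mx_norm1 A ^+ 2) (mx_norm1 A)) => k.
rewrite pseries_diffs2_expmx_coeff normrM mulrA -exprD mulrC.
rewrite [X in _ * X <= _]ger0_norm ?invr_ge0//.
by apply: ler_wpM2r; rewrite ?invr_ge0 ?expmx_entry_bound.
Qed.

Lemma cvg_mx m p (u : nat -> 'M[R]_(m, p)) (L : 'M[R]_(m, p)) :
  (forall i j, (fun k => u k i j) @ \oo --> L i j) -> u @ \oo --> L.
Proof.
move=> uL; apply/cvg_mx_entourageP => X entX; rewrite near_simpl.
have : \forall N \near \oo, forall ij : 'I_m * 'I_p,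
    (L ij.1 ij.2, u N ij.1 ij.2) \in X.
  apply: filter_forall => -[i j] /=.
  have /cvg_app_entourageP/(_ _ entX) := uL i j.
  by apply: filterS => N; rewrite inE.
by apply: filterS => N H i j; exact: (H (i, j)).
Qed.

Lemma exprZmx A (s : R) k : (s *: A) ^+ k = s ^+ k *: A ^+ k.
Proof.
elim: k => [|k ih]; first by rewrite !expr0 scale1r.
by rewrite !exprS ih -!mulmxE -scalemxAl -scalemxAr scalerA.
Qed.

Lemma expmxE A s i j :
  (expmx (s *: A)) i j = limn (pseries (expmx_coeff A i j) s).
Proof.
pose L : 'M[R]_n := \matrix_(i, j) limn (pseries (expmx_coeff A i j) s).
suff -> : expmx (s *: A) = L by rewrite mxE.
apply: cvg_lim => //; apply: cvg_mx => k l; rewrite mxE.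
rewrite (_ : (fun _ => _) = pseries (expmx_coeff A k l) s).
  exact: is_cvg_expmx_coeff.
apply/funext => N; rewrite /series/= summxE; apply: eq_bigr => r _.
by rewrite mxE exprZmx mxE /expmx_coeff mulrA mulrAC.
Qed.

Lemma cvg_expmx_coeff A s i j :
  pseries (expmx_coeff A i j) s @ \oo --> (expmx (s *: A)) i j.
Proof. by rewrite expmxE; exact: is_cvg_expmx_coeff. Qed.

Lemma is_derive_expmx_lim A s i j : is_derive s (1 : R)
  (fun t => (expmx (t *: A)) i j)
  (limn (pseries (pseries_diffs (expmx_coeff A i j)) s)).
Proof.
under [X in is_derive _ _ X]eq_fun do rewrite expmxE.
apply: (@pseries_snd_diffs _ _ (`|s| + 1)).
- exact: is_cvg_expmx_coeff.
- exact: is_cvg_diffs_expmx_coeff.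
- exact: is_cvg_diffs2_expmx_coeff.
- by rewrite [ltRHS]ger0_norm ?addr_ge0// ltrDl.
Qed.

(** One factor of [A ^+ k.+1] is split off on the right here and on the left in the next lemma;
    comparing the two gives commutation with the exponential. *)
Lemma pseries_diffs_mulmxr A s i j :
  limn (pseries (pseries_diffs (expmx_coeff A i j)) s)
  = (expmx (s *: A) *m A) i j.
Proof.
rewrite mxE; apply: cvg_lim => //.
rewrite [X in X @ _](_ : _ = fun N => \sum_l
    pseries (expmx_coeff A i l) s N * A l j).
  apply: cvg_fin_sum => l _; apply: cvgMl; exact: cvg_expmx_coeff.
apply/funext => N; rewrite /pseries/series/=.
under [RHS]eq_bigr do rewrite mulr_suml.
rewrite exchange_big/=; apply: eq_bigr => k _.
rewrite pseries_diffs_expmx_coeff exprSr mxE mulr_sumr mulr_suml.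
by apply: eq_bigr => l _; rewrite /expmx_coeff; ring.
Qed.

Lemma pseries_diffs_mulmxl A s i j :
  limn (pseries (pseries_diffs (expmx_coeff A i j)) s)
  = (A *m expmx (s *: A)) i j.
Proof.
rewrite mxE; apply: cvg_lim => //.
rewrite [X in X @ _](_ : _ = fun N => \sum_l
    A i l * pseries (expmx_coeff A l j) s N).
  apply: cvg_fin_sum => l _; apply: cvgMr; exact: cvg_expmx_coeff.
apply/funext => N; rewrite /pseries/series/=.
under [RHS]eq_bigr do rewrite mulr_sumr.
rewrite exchange_big/=; apply: eq_bigr => k _.
rewrite pseries_diffs_expmx_coeff exprS mxE mulr_sumr mulr_suml.
by apply: eq_bigr => l _; rewrite /expmx_coeff; ring.
Qed.

Lemma expmx_comm A s : expmx (s *: A) *m A = A *m expmx (s *: A).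
Proof.
by apply/matrixP => i j; rewrite -pseries_diffs_mulmxr pseries_diffs_mulmxl.
Qed.

Lemma is_derive_expmx A s i j : is_derive s (1 : R)
  (fun t => (expmx (t *: A)) i j) ((A *m expmx (s *: A)) i j).
Proof. by rewrite -pseries_diffs_mulmxl; exact: is_derive_expmx_lim. Qed.

Lemma expmx0 A : expmx (0 *: A) = 1%:M.
Proof.
apply/matrixP => i j; rewrite expmxE.
apply/cvg_lim => //; apply: cvg_near_cst.
exists 1%N => // N /= N1; rewrite /pseries/series/= -(prednK N1).
rewrite big_nat_recl//= big1 ?addr0 /expmx_coeff
  ?fact0 ?expr0 ?invr1 ?mul1r ?mulr1//.
by move=> k _; rewrite [0 ^+ _]exprS mul0r mulr0.
Qed.

(** The partial sums of the series are polynomials in [A], each killed between [r] and [b]; the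
    product is their limit. *)
Lemma mul_expmx_eq0 A s m p (r : 'M[R]_(m, n)) (b : 'M[R]_(n, p)) :
  (forall k, r *m A ^+ k *m b = 0) -> r *m expmx (s *: A) *m b = 0.
Proof.
move=> rb0; apply/matrixP => i j.
have H : (fun N => (r *m (\matrix_(k, l) pseries (expmx_coeff A k l) s N) *m b) i j)
    @ \oo --> (r *m expmx (s *: A) *m b) i j.
  rewrite [X in X @ _](_ : _ = fun N => \sum_l \sum_k
      r i k * pseries (expmx_coeff A k l) s N * b l j).
    rewrite mxE; apply: cvg_fin_sum => l _; rewrite mxE mulr_suml.
    apply: cvg_fin_sum => k _; apply: cvgMl; apply: cvgMr; exact: cvg_expmx_coeff.
  apply/funext => N; rewrite mxE; apply: eq_bigr => l _.
  by rewrite mxE mulr_suml; apply: eq_bigr => k _; rewrite !mxE.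
rewrite -(cvg_lim _ H)//; apply: cvg_lim => //.
rewrite [X in X @ _](_ : _ = cst 0); first by rewrite mxE; exact: cvg_cst.
apply/funext => N /=.
rewrite (_ : \matrix_(_, _) _ = \sum_(0 <= k < N) (k`!%:R^-1 * s ^+ k) *: A ^+ k).
  rewrite mulmx_sumr mulmx_suml big1 ?mxE// => k _.
  by rewrite -scalemxAr -scalemxAl rb0 scaler0.
apply/matrixP => k l; rewrite summxE mxE; apply: eq_bigr => q _.
by rewrite mxE /expmx_coeff mulrAC.
Qed.

Lemma is_derive_mul_expmx A s m p (r : 'M[R]_(m, n)) (b : 'M[R]_(n, p)) i j :
  is_derive s (1 : R) (fun t => (r *m expmx (t *: A) *m b) i j)
    ((r *m A *m expmx (s *: A) *m b) i j).
Proof.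
rewrite [X in is_derive _ _ X](_ : _ = \sum_l \sum_k
   (fun t => r i k * expmx (t *: A) k l * b l j)).
  have -> : (r *m A *m expmx (s *: A) *m b) i j =
     \sum_l \sum_k r i k * (A *m expmx (s *: A)) k l * b l j.
    rewrite mxE; apply: eq_bigr => l _.
    by rewrite -mulmxA mxE mulr_suml.
  apply: is_derive_sum => l; apply: is_derive_sum => k.
  have dE := is_derive_expmx A s k l.
  rewrite (_ : (fun _ => _) = (r i k * b l j) *: (fun t => (expmx (t *: A)) k l)).
    by apply: is_derive_eq; rewrite /GRing.scale/= mulrAC.
  by apply/funext => t; rewrite fctE /GRing.scale/= mulrAC.
apply/funext => t; rewrite fct_sumE mxE; apply: eq_bigr => l _.
by rewrite mxE mulr_suml fct_sumE.
Qed.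
End expmx_theory.

(** * Level sets of analytic functions *)

Section null_level_sets.
Variable R : realType.

Lemma near_nonzero (h : R -> R) s : {for s, continuous h} -> h s != 0 ->
  \forall t \near s, h t != 0.
Proof.
by move=> hs hs0; exact: (cvgr_neq0 _ hs hs0).
Qed.

(* Induction on k: by Rolle, a second zero of h 0 near s would force a zero of
   h 1 in between. *)
Lemma derivs_near_nonzero (k : nat) (h : nat -> R -> R) s :
  (forall i x, is_derive x (1 : R) (h i) (h i.+1 x)) -> h k s != 0 ->
  \forall t \near s^', h 0%N t != 0.
Proof.
elim: k h => [|k ih] h dh hs.
  apply: nbhs_dnbhs; apply: near_nonzero => //.
  by apply: differentiable_continuous; apply/derivable1_diffP; case: (dh 0%N s).
have ch x : {for x, continuous (h 0%N)}.
  by apply: differentiable_continuous; apply/derivable1_diffP; case: (dh 0%N x).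
have [h0|h0] := eqVneq (h 0%N s) 0; last first.
  by apply: nbhs_dnbhs; exact: near_nonzero.
have := ih (fun i => h i.+1) (fun i => dh i.+1) hs.
rewrite !near_withinE => /nbhs_ballP[r /= r0 hr].
apply/nbhs_ballP; exists r => //= t st ts; apply/negP => /eqP ht0.
have rolle a b : a < b -> h 0%N a = h 0%N b -> exists2 c, a < c < b & h 1%N c = 0.
  move=> ab hab; have [|||c cab dc] := @Rolle R (h 0%N) a b ab.
  - by move=> x _; case: (dh 0%N x).
  - exact: continuous_subspaceT.
  - exact: hab.
  exists c; first by move: cab; rewrite in_itv.
  by have [_ <-] := dh 0%N c; have [_ ->] := dc.
move: st; rewrite /ball/= => st.
have : exists c, [/\ c != s, `|s - c| < r & h 1%N c = 0].
  have [lt_st|lt_ts|e] := ltgtP s t; last by rewrite e eqxx in ts.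
  - have [c /andP[c1 c2] hc] := rolle s t lt_st (etrans h0 (esym ht0)).
    exists c; split; [by rewrite gt_eqF| |by []].
    rewrite ltr0_norm ?subr_lt0//; move: st; rewrite ltr0_norm ?subr_lt0//; lra.
  - have [c /andP[c1 c2] hc] := rolle t s lt_ts (etrans ht0 (esym h0)).
    exists c; split; [by rewrite lt_eqF| |by []].
    rewrite gtr0_norm ?subr_gt0//; move: st; rewrite gtr0_norm ?subr_gt0//; lra.
by case=> c [cs cr hc]; have := hr c cr cs; rewrite hc eqxx.
Qed.

(** Every zero has a punctured neighbourhood free of zeros, and a set of isolated points of the line
    is countable. *)
Lemma derivs_countable_zeros (h : nat -> R -> R) :
  (forall i x, is_derive x (1 : R) (h i) (h i.+1 x)) ->
  (forall s, exists k, h k s != 0) ->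
  countable [set s | h 0%N s = 0].
Proof.
move=> dh hN0; set Z := [set _ | _].
suff -> : Z = isolated Z by exact: countable_isolated.
apply/seteqP; split; last exact: isolatedS.
move=> s Zs; split; first exact/mem_set.
have [k hk] := hN0 s; have := derivs_near_nonzero dh hk.
rewrite near_withinE => Vs; exists [set t | t != s -> h 0%N t != 0] => //.
apply/seteqP; split => t /=; last by move=> ->; rewrite eqxx.
by move=> [] /[swap] ht; apply: contraPP => /eqP /[swap] /[apply]; rewrite ht eqxx.
Qed.

End null_level_sets.

(** * Inverse of the exponential, and switching functions *)

Section expmx_inverse.
Variables (R : realType) (n : nat).
Implicit Types A : 'M[R]_n.

(** The product has derivative zero in [s], since [A] commutes with its exponential, and it is the
    identity at 0. *)
Lemma expmx_mulN A s : expmx (s *: A) *m expmx (s *: - A) = 1%:M.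
Proof.
apply/matrixP => i j.
pose h : R -> R := fun t => (expmx (t *: A) *m expmx (t *: - A)) i j.
have hE : h = \sum_l
    ((fun t => (expmx (t *: A)) i l) * (fun t => (expmx (t *: - A)) l j)).
  by apply/funext => t; rewrite fct_sumE /h mxE.
have dh t : is_derive t (1 : R) h 0.
  rewrite hE.
  have -> : 0 = \sum_l
     ((expmx (t *: A)) i l *: (- A *m expmx (t *: - A)) l j
      + (expmx (t *: - A)) l j *: (A *m expmx (t *: A)) i l); last first.
    apply: is_derive_sum => l; apply: is_deriveM; exact: is_derive_expmx.
  apply/esym.
  rewrite big_split/= /GRing.scale/=.
  under [X in _ + X]eq_bigr do rewrite mulrC.
  have -> : \sum_l (expmx (t *: A)) i l * (- A *m expmx (t *: - A)) l j =
      (expmx (t *: A) *m (- A *m expmx (t *: - A))) i j by rewrite [RHS]mxE.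
  have -> : \sum_l (A *m expmx (t *: A)) i l * (expmx (t *: - A)) l j =
      (A *m expmx (t *: A) *m expmx (t *: - A)) i j by rewrite [RHS]mxE.
  by rewrite -expmx_comm mulNmx mulmxN -mulmxA mxE addNr.
rewrite -/(h s) (is_derive_0_is_cst s 0 dh) /h.
by rewrite !expmx0 mulmx1.
Qed.

Lemma mul_expmx_inj A s m (p : 'M[R]_(m, n)) : p *m expmx (s *: A) = 0 -> p = 0.
Proof.
by move=> p0; rewrite -[p]mulmx1 -(expmx_mulN A s) mulmxA p0 mul0mx.
Qed.

Lemma expmx_commX A s k : expmx (s *: A) *m A ^+ k = A ^+ k *m expmx (s *: A).
Proof.
elim: k => [|k ih]; first by rewrite expr0 mul1mx mulmx1.
by rewrite exprS -mulmxE mulmxA expmx_comm -mulmxA ih mulmxA.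
Qed.

(* p e^{-sA} B, the integrand of the linear functional u |-> p (int e^{-sA} B u). *)
Definition switching A (B : 'cV[R]_n) (p : 'rV[R]_n) (s : R) : R :=
  (p *m expmx (- (s *: A)) *m B) 0 0.

(** Differentiation acts on [p] alone, so all higher derivatives stay in the same family of
    functions. *)
Lemma is_derive_switching A B p s :
  is_derive s (1 : R) (switching A B p) (switching A B (p *m - A) s).
Proof.
rewrite /switching.
under [X in is_derive _ _ X]eq_fun do rewrite -scalerN.
rewrite -scalerN; exact: is_derive_mul_expmx.
Qed.

Lemma continuous_switching A B p : continuous (switching A B p).
Proof.
move=> s; apply: differentiable_continuous; apply/derivable1_diffP.
by case: (is_derive_switching A B p s).
Qed.

Lemma switchingD A B p q s :
  switching A B (p + q) s = switching A B p s + switching A B q s.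
Proof. by rewrite /switching !mulmxDl mxE. Qed.

Lemma switchingZ A B a p s :
  switching A B (a *: p) s = a * switching A B p s.
Proof. by rewrite /switching -!scalemxAl mxE. Qed.

Lemma switchingE A B p s :
  switching A B p s = \sum_i p 0 i * (expmx (- (s *: A)) *m B) i 0.
Proof. by rewrite /switching -mulmxA mxE. Qed.

End expmx_inverse.

(** * Bounded measurable functions on an interval *)

Section bounded_measurable.
Variables (R : realType) (T : R).
Hypothesis T_ge0 : 0 <= T.
Notation mu := (@lebesgue_measure R).
Notation Int h := (\int[mu]_(s in `[0, T]) h s).
Implicit Types (g h u v : R -> R).

(** A class stable under the algebraic operations and contained in the integrable functions; it
    settles the side conditions of linearity and monotonicity of the integral. *)
Definition bounded_measurable h : Prop :=
  measurable_fun `[0, T] h /\ exists M, forall s, s \in `[0, T] -> `|h s| <= M.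

Lemma bmeasD g h : bounded_measurable g -> bounded_measurable h ->
  bounded_measurable (fun s => g s + h s).
Proof.
move=> [mg [M gM]] [mh [N hN]]; split; first exact: measurable_funD.
by exists (M + N) => s sT; rewrite (le_trans (ler_normD _ _))// lerD ?gM ?hN.
Qed.

Lemma bmeasN g : bounded_measurable g -> bounded_measurable (fun s => - g s).
Proof.
move=> [mg [M gM]]; split; first exact: measurableT_comp.
by exists M => s sT; rewrite normrN gM.
Qed.

Lemma bmeasM g h : bounded_measurable g -> bounded_measurable h ->
  bounded_measurable (fun s => g s * h s).
Proof.
move=> [mg [M gM]] [mh [N hN]]; split; first exact: measurable_funM.
by exists (M * N) => s sT; rewrite normrM ler_pM ?gM ?hN.
Qed.

Lemma bmeas_norm g : bounded_measurable g -> bounded_measurable (fun s => `|g s|).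
Proof.
move=> [mg [M gM]]; split; first exact: measurableT_comp.
by exists M => s sT; rewrite normr_id gM.
Qed.

Lemma bmeas_cst (c : R) : bounded_measurable (fun=> c).
Proof. by split; [exact: measurable_cst|exists `|c|]. Qed.

Lemma bmeas_indic (S : set R) : measurable S -> bounded_measurable (\1_S).
Proof.
move=> mS; split; first exact: measurable_indic.
by exists 1 => s _; rewrite indicE; case: (s \in S); rewrite ?normr0 ?normr1.
Qed.

Lemma bmeas_continuous g : continuous g -> bounded_measurable g.
Proof.
move=> cg; split; first by apply: measurable_funTS; exact: continuous_measurable_fun.
have [c cT gc] := @EVT_max R (fun s => `|g s|) 0 T T_ge0
  (continuous_subspaceT (fun x => cvg_norm (cg x))).
by exists `|g c|.
Qed.

Lemma bmeas_integrable g :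
  bounded_measurable g -> mu.-integrable `[0, T] (EFin \o g).
Proof.
move=> [mg [M gM]]; apply: measurable_bounded_integrable => //.
  by rewrite /= lebesgue_measure_itv/=; case: ifP => _; rewrite ?ltry// -EFinB ltry.
exists M; split; first exact: num_real.
by move=> x Mx s /= sT; rewrite (le_trans (gM s sT))// ltW.
Qed.

Lemma bmeas_RintegralD g h : bounded_measurable g -> bounded_measurable h ->
  Int (fun s => g s + h s) = Int g + Int h.
Proof. by move=> bg bh; rewrite RintegralD//; exact: bmeas_integrable. Qed.

Lemma bmeas_RintegralB g h : bounded_measurable g -> bounded_measurable h ->
  Int (fun s => g s - h s) = Int g - Int h.
Proof. by move=> bg bh; rewrite RintegralB//; exact: bmeas_integrable. Qed.

Lemma bmeas_RintegralZ a g : bounded_measurable g ->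
  Int (fun s => a * g s) = a * Int g.
Proof. by move=> bg; rewrite RintegralZl//; exact: bmeas_integrable. Qed.

Lemma bmeas_le_Rintegral g h : bounded_measurable g -> bounded_measurable h ->
  (forall s, s \in `[0, T] -> g s <= h s) -> Int g <= Int h.
Proof.
by move=> bg bh gh; apply: le_Rintegral => //; exact: bmeas_integrable.
Qed.

Lemma fine_mu_itv : fine (mu `[0, T]%classic) = T.
Proof.
rewrite /= lebesgue_measure_itv/= lte_fin; case: ifPn => /= [_|]; rewrite ?subr0//.
by rewrite -leNgt => T_le0; apply/eqP; rewrite eq_le T_ge0 T_le0.
Qed.

Lemma bmeas_Rintegral_cst c : Int (fun=> c) = c * T.
Proof. by rewrite Rintegral_cst// fine_mu_itv. Qed.

Lemma bmeas_Rintegral_indic (S : set R) : measurable S ->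
  Int (\1_S) = fine (mu (S `&` `[0, T])).
Proof. by move=> mS; rewrite /Rintegral integral_indic. Qed.

Lemma closed_sublevel h (d : R) : continuous h -> closed [set s | `|h s| <= d].
Proof.
move=> ch; rewrite (_ : [set _ | _] = (fun s => `|h s|) @^-1` [set x | x <= d])//.
apply: closed_comp => [x _|]; last exact: closed_le.
exact: cvg_norm (ch x).
Qed.

(** Continuity of the measure from above along the sets [|h| <= 1/(k+1)], cut down to [[0, T]] so as
    to have finite measure; they decrease to a part of the null zero set. *)
Lemma small_sublevel h (e : R) : continuous h -> mu [set s | h s = 0] = 0%E ->
  0 < e -> exists2 d : R, 0 < d & Int (\1_[set s | `|h s| <= d]) <= e.
Proof.
move=> ch h0 e0.
pose F (k : nat) := [set s | `|h s| <= k.+1%:R^-1] `&` `[0, T]%classic.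
have mS (d : R) : measurable [set s | `|h s| <= d].
  by apply: closed_measurable; exact: closed_sublevel.
have mF k : measurable (F k) by exact: measurableI.
have Fcap : \bigcap_k F k `<=` [set s | h s = 0].
  move=> s Fs /=; apply/eqP; rewrite -normr_eq0 eq_le normr_ge0 andbT.
  apply/ler_addgt0Pr => x x0; rewrite add0r.
  have [k kx] := ltr_add_invr x0; rewrite add0r in kx.
  by have [/= hs _] := Fs k I; rewrite (le_trans hs)// ltW.
have mcap : measurable (\bigcap_k F k) by exact: bigcap_measurable.
have mu0 : mu (\bigcap_k F k) = 0%E.
  apply/eqP; rewrite eq_le measure_ge0 andbT -h0.
  apply: le_measure => //; rewrite inE//.
  rewrite (_ : [set _ | _] = [set s | `|h s| <= 0]); first exact: mS.
  apply/seteqP; split => s /=; first by move=> ->; rewrite normr0.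
  by rewrite normr_le0 => /eqP.
have muT : (mu `[0%R, T]%classic < +oo)%E.
  by rewrite /= lebesgue_measure_itv/=; case: ifP => _; rewrite ?ltry// -EFinB ltry.
have muF k : (mu (F k) < +oo)%E.
  have FT : F k `<=` `[0, T]%classic by exact: subIsetr.
  by rewrite (le_lt_trans _ muT)// le_measure// inE//; exact: mF.
have Fcvg : mu \o F @ \oo --> 0%E.
  rewrite -mu0; apply: nonincreasing_cvg_mu => //; first exact: muF.
  apply/nonincreasing_seqP => k; apply/subsetPset; apply: setSI => s /= hs.
  by rewrite (le_trans hs)// lef_pV2 ?posrE// ler_nat.
have /fine_cvgP[_ /cvgrPdist_le /(_ _ e0)[k _ /(_ k (leqnn k)) /=]] := Fcvg.
rewrite sub0r normrN ger0_norm ?fine_ge0// => muFk.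
by exists k.+1%:R^-1; rewrite ?invr_gt0// bmeas_Rintegral_indic.
Qed.

End bounded_measurable.

(** * Switching functions and controllability *)

Section switching_theory.
Variables (R : realType) (n : nat).
Notation mu := (@lebesgue_measure R).
Implicit Types (A : 'M[R]_n) (B : 'cV[R]_n) (p q : 'rV[R]_n).

Lemma le_coord_norm m k (M : 'M[R]_(m, k)) i j : `|M i j| <= `|M|.
Proof.
have -> : `|M| = mx_norm M by []; rewrite mx_normrE; apply/bigmax_geP; right => /=.
by exists (i, j).
Qed.

Lemma Rintegral_fin_sum (J : Type) (r : seq J) (D : set R) (F : J -> R -> R) :
  measurable D -> (forall j, mu.-integrable D (EFin \o F j)) ->
  \int[mu]_(s in D) (\sum_(j <- r) F j s) = \sum_(j <- r) \int[mu]_(s in D) F j s.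
Proof.
move=> mD iF; elim: r => [|j r ih].
  rewrite big_nil; under eq_Rintegral do rewrite big_nil.
  by rewrite Rintegral_cst// mul0r.
rewrite big_cons -ih -RintegralD//.
  by apply: eq_Rintegral => s _; rewrite big_cons.
rewrite (_ : EFin \o _ = fun s => (\sum_(j <- r) (F j s)%:E)%E).
  by apply: integrable_sum => // i _; exact: iF.
by apply/funext => s /=; rewrite sumEFin.
Qed.

Lemma input_entryE A B i s :
  (expmx (- (s *: A)) *m B) i 0 = switching A B (delta_mx 0 i) s.
Proof. by rewrite /switching -mulmxA -rowE [RHS]mxE. Qed.

Lemma integrable_switchingM A B p (t : R) u : 0 <= t -> L1_control t u ->
  mu.-integrable `[0, t] (EFin \o (fun s => switching A B p s * u s)).
Proof.
move=> t0 uL1.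
have [mg [M gM]] := bmeas_continuous t0 (@continuous_switching _ _ A B p).
apply: (@integrableMr _ _ _ mu _ _ (switching A B p) (EFin \o u)) => //.
exists M; split; first exact: num_real.
by move=> x Mx s /= sT; rewrite (le_trans (gM s sT))// ltW.
Qed.

Lemma mul_input_integral A B p (t : R) u : 0 <= t -> L1_control t u ->
  (p *m input_integral A B t u) 0 0
  = \int[mu]_(s in `[0, t]) (switching A B p s * u s).
Proof.
move=> t0 uL1; rewrite mxE.
have iu i := integrable_switchingM A B (delta_mx 0 i) t0 uL1.
transitivity (\sum_i \int[mu]_(s in `[0, t])
    (p 0 i * (switching A B (delta_mx 0 i) s * u s))).
  apply: eq_bigr => i _; rewrite mxE RintegralZl//; congr (_ * _).
  by apply: eq_Rintegral => s _; rewrite input_entryE.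
rewrite -Rintegral_fin_sum//; last first.
  by move=> i; apply: (@integrableZl _ _ _ _ _ _ (p 0 i) _ (iu i)).
apply: eq_Rintegral => s _; rewrite switchingE mulr_suml.
by apply: eq_bigr => i _; rewrite -input_entryE mulrA.
Qed.

(** Steer 0 to [p^T]: pairing the final state with [p] gives the squared Euclidean norm of [p] on
    one side, and on the other an integral whose integrand vanishes identically. *)
Lemma controllable_row_eq0 A B p : controllable A B ->
  (forall k, p *m A ^+ k *m B = 0) -> p = 0.
Proof.
move=> AB pAB; have [t [u [t0 uL1 st]]] := AB 0 p^T.
have pE0 s : switching A B (p *m expmx (t *: A)) s = 0.
  rewrite /switching -scaleNr [_ *m B](_ : _ = 0) ?mxE//.
  apply: mul_expmx_eq0 => k.
  rewrite -[_ *m _ *m A ^+ k]mulmxA expmx_commX mulmxA.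
  by apply: mul_expmx_eq0 => j; rewrite -[p *m _ *m _]mulmxA mulmxE -exprD.
have : (p *m p^T) 0 0 = 0.
  rewrite -st /state_at add0r mulmxA mul_input_integral ?ltW//.
  under eq_Rintegral do rewrite pE0 mul0r.
  by rewrite Rintegral_cst// mul0r.
rewrite mxE => /eqP; rewrite psumr_eq0.
  move=> /allP p0; apply/rowP => i; have := p0 i (mem_index_enum _).
  by rewrite !mxE mulf_eq0 orbb => /eqP.
by move=> i _; rewrite !mxE -expr2 sqr_ge0.
Qed.

(* If all derivatives +- p A^k e^{-sA} B, k >= 1, vanish at some s, then
   p A e^{-sA} = 0 by controllability and p = 0 since A is invertible. *)
Lemma switching_level_null A B p (c : R) : controllable A B -> A \in unitmx ->
  p != 0 -> mu [set s | switching A B p s = c] = 0%E.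
Proof.
move=> AB uA p0.
(* The constant [c] sits in the function of index 0 only, so homogeneous equations come from orders
   at least 1; hence the factor [A] to be cancelled at the end. *)
pose h k s := if k is 0%N then switching A B p s - c
              else switching A B (p *m (- A) ^+ k) s.
suff : countable [set s | h 0%N s = 0].
  move/countable_lebesgue_measure0.
  rewrite (_ : [set _ | _] = [set s | h 0%N s = 0])//.
  apply/seteqP; split => s /=; first by move=> ->; rewrite subrr.
  by move/eqP; rewrite subr_eq0 => /eqP.
apply: derivs_countable_zeros => [[|k] s|s].
- rewrite /h expr1 -[X in is_derive _ _ _ X]subr0.
  by apply: is_deriveB; exact: is_derive_switching.
- rewrite /h [in X in is_derive _ _ _ X]exprSr -mulmxE mulmxA.
  exact: is_derive_switching.
apply: contrapT => /forallNP hs0.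
have {}hs0 k : switching A B (p *m (- A) ^+ k.+1) s = 0.
  by have /negP := hs0 k.+1; rewrite negbK => /eqP.
suff : p *m - A = 0.
  rewrite mulmxN => /eqP; rewrite oppr_eq0 => /eqP pA.
  by move: p0; rewrite -(mulmxK uA p) pA mul0mx eqxx.
apply: (@mul_expmx_inj _ _ (- A) s); apply: (controllable_row_eq0 AB) => k.
have -> : A ^+ k = (-1) ^+ k *: (- A) ^+ k by rewrite -exprZmx scaleN1r opprK.
rewrite -scalemxAr -scalemxAl -[_ *m _ *m (- A) ^+ k]mulmxA expmx_commX mulmxA.
rewrite -[p *m - A *m _]mulmxA mulmxE -exprS.
apply/matrixP => i j; rewrite !ord1 [LHS]mxE.
by have := hs0 k; rewrite /switching -scalerN => ->; rewrite mulr0 mxE.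
Qed.

Lemma switching_bound A B (T : R) : 0 <= T -> exists2 M : R, 0 < M &
  forall p s, s \in `[0, T] -> `|switching A B p s| <= M * `|p|.
Proof.
move=> T0.
have /fin_all_exists[M hM] i : exists M : R, forall s, s \in `[0, T] ->
    `|switching A B (delta_mx 0 i) s| <= M.
  by have [_] := bmeas_continuous T0 (@continuous_switching _ _ A B (delta_mx 0 i)).
have M0 i : 0 <= M i.
  by rewrite (le_trans _ (hM i 0 _))// in_itv/= lexx.
exists (\sum_i M i + 1); first by rewrite ltr_wpDl// sumr_ge0.
move=> p s sT; rewrite mulrDl mul1r -[leLHS]addr0 lerD// switchingE.
rewrite (le_trans (ler_norm_sum _ _ _))// mulr_suml ler_sum// => i _.
by rewrite normrM mulrC ler_pM// ?input_entryE ?hM// le_coord_norm.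
Qed.

End switching_theory.

(** * Bang-off-bang controls and duality *)

Section bang_off_bang.
Variable R : realType.
Implicit Types (y w d m : R).

(** A minimiser of [|w| - y * w] over [|w| <= 1]. As a difference of two indicators it is measurable
    after composition with a continuous function. *)
Definition bang y : R := (1 < y)%R%:R - (y < -1)%R%:R.

(** Minus the minimum of [|w| - y * w] over [|w| <= 1]: the integrand of the dual function. *)
Definition dead_zone y : R := Num.max (`|y| - 1) 0.

Lemma bang_gt1 y : 1 < y -> bang y = 1.
Proof.
by move=> y1; rewrite /bang y1 ltNge (_ : -1 <= y) ?subr0//; lra.
Qed.

Lemma bang_ltN1 y : y < -1 -> bang y = -1.
Proof.
by move=> y1; rewrite /bang y1 ltNge (_ : y <= 1) ?sub0r//; lra.
Qed.

Lemma bang_small y : -1 <= y -> y <= 1 -> bang y = 0.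
Proof. by move=> y1 y2; rewrite /bang !ltNge y1 y2 subrr. Qed.

Variant bang_spec y : R -> Type :=
  | BangPos of 1 < y : bang_spec y 1
  | BangNeg of y < -1 : bang_spec y (-1)
  | BangZero of -1 <= y & y <= 1 : bang_spec y 0.

Lemma bangP y : bang_spec y (bang y).
Proof.
have [y1|y1] := ltP 1 y; first by rewrite bang_gt1//; constructor.
have [y2|y2] := ltP y (-1); first by rewrite bang_ltN1//; constructor.
by rewrite bang_small//; constructor.
Qed.

Lemma norm_bang_le1 y : `|bang y| <= 1.
Proof. by case: bangP; rewrite ?normr1 ?normrN1 ?normr0. Qed.

Lemma dead_zone_ge y : `|y| - 1 <= dead_zone y.
Proof. by rewrite /dead_zone le_max lexx. Qed.

Lemma dead_zone_lip y w : dead_zone y - dead_zone w <= `|y - w|.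
Proof.
rewrite /dead_zone !maxEle.
have := ler_distD 0 y w; rewrite !subr0 sub0r normrN => _.
have H : `|y| <= `|w| + `|y - w| by have := ler_normD w (y - w); rewrite addrC subrK.
have H0 := normr_ge0 (y - w).
by do 2 case: ifPn; rewrite -?ltNge => ? ?; lra.
Qed.

(** For [y > 1], [|w| - y * w >= (1 - y) * w >= 1 - y]; the case [y < -1] is symmetric, and for
    [|y| <= 1] the right side is nonnegative. *)
Lemma bang_minimizes y w : `|w| <= 1 ->
  `|bang y| - y * bang y <= `|w| - y * w.
Proof.
move=> w1; have := ler_norm w; have := ler_norm (- w); rewrite normrN.
have w0 := normr_ge0 w.
case: bangP => [y1|y1|y1 y2] wN wP; rewrite ?normr1 ?normrN1 ?normr0.
- by nra.
- by nra.
- by nra.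
Qed.

(* [bang] is the derivative of [dead_zone] off |y| = 1, with an error term that
   only lives near |y| = 1. *)
Lemma dead_zone_variation y d m : `|d| <= m ->
  dead_zone (y + d) - dead_zone y
  <= d * bang y + 2 * m * (`| `|y| - 1| <= m)%R%:R.
Proof.
move=> dm; have := ler_norml d m; rewrite dm => /esym/andP[dm1 dm2].
(* Near the kink the Lipschitz bound [m] suffices, the factor 2 making up for [d * bang y >= - m].
   Farther away [y] and [y + d] lie on the same affine piece. *)
case: (boolP (_ <= m)) => [_|]; rewrite ?mulr1 ?mulr0 ?addr0.
  have := dead_zone_lip (y + d) y; rewrite addrAC subrr add0r => H.
  by case: bangP => *; lra.
rewrite -ltNge => ym; rewrite /dead_zone; case: bangP => [y1|y1|y1 y2].
- have y0 : 0 <= y by lra.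
  move: ym; rewrite (ger0_norm y0) ger0_norm; last lra.
  move=> ym; have yd0 : 0 <= y + d by lra.
  by rewrite (ger0_norm yd0) !max_l; lra.
- have y0 : y <= 0 by lra.
  move: ym; rewrite (ler0_norm y0) ger0_norm; last lra.
  move=> ym; have yd0 : y + d <= 0 by lra.
  by rewrite (ler0_norm yd0) !max_l; lra.
- have yn : `|y| <= 1 by rewrite ler_norml y1.
  move: ym; rewrite ler0_norm; last lra.
  have := ler_normD y d => H ym.
  by rewrite !max_r; lra.
Qed.

End bang_off_bang.

(** * Comparison of the L0 and L1 norms *)

Section L0_L1.
Variables (R : realType) (T : R).
Hypothesis T_ge0 : 0 <= T.
Notation mu := (@lebesgue_measure R).
Notation Int h := (\int[mu]_(s in `[0, T]) h s).
Implicit Types (h u v : R -> R).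

Lemma bounded_control_bmeas v : bounded_control T v -> bounded_measurable T v /\
  forall s, s \in `[0, T] -> `|v s| <= 1.
Proof.
move=> [vL1 v1].
have {}v1 s : s \in `[0, T] -> `|v s| <= 1.
  move=> sT; rewrite -lee_fin; apply: le_trans v1.
  by apply: ereal_sup_ubound; exists s.
split => //; split; last by exists 1.
by apply/measurable_EFinP; exact: measurable_int vL1.
Qed.

Lemma bmeas_bounded_control v : bounded_measurable T v ->
  (forall s, s \in `[0, T] -> `|v s| <= 1) -> bounded_control T v.
Proof.
move=> bv v1; split; first exact: bmeas_integrable.
by apply: ge_ereal_sup => _ [s sT <-]; rewrite lee_fin v1.
Qed.

Lemma measurable_level h (c : R) : continuous h -> measurable [set s | h s = c].
Proof.
move=> ch; apply: closed_measurable.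
rewrite (_ : [set _ | _] = h @^-1` [set c])//.
by apply: closed_comp => [x _|]; [exact: ch|exact: closed_eq].
Qed.

Lemma null_setU (X Y : set R) : measurable X -> measurable Y ->
  mu X = 0%E -> mu Y = 0%E -> mu (X `|` Y) = 0%E.
Proof.
move=> mX mY X0 Y0; apply/eqP; rewrite eq_le measure_ge0 andbT.
have U : (mu (X `|` Y) <= mu X + mu Y)%E by exact: measureU2.
by rewrite (le_trans U)// X0 Y0 adde0.
Qed.

Lemma closure_supp_sub v (F : set R) : closed F ->
  (forall s, s \in `[0, T] -> v s != 0 -> F s) ->
  closure [set t : R | t \in `[0, T] /\ v t != 0] `<=` F.
Proof.
move=> cF vF; rewrite [X in _ `<=` X](closure_id F).1//.
by apply: closureS => s /= [sT vs]; exact: vF.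
Qed.

Lemma mu_itv : mu `[0, T]%classic = T%:E.
Proof.
by rewrite -[in RHS](fine_mu_itv T_ge0) fineK// /= lebesgue_measure_itv/=; case: ifP.
Qed.

Lemma L0_norm_le v : (L0_norm T v <= T%:E)%E.
Proof.
rewrite -mu_itv; apply: le_measure; rewrite ?inE//.
  by apply: closed_measurable; exact: closed_closure.
by apply: closure_supp_sub => //; exact: itv_closed.
Qed.

Lemma L1_le_T v : bounded_control T v -> Int (fun s => `|v s|) <= T.
Proof.
move=> /bounded_control_bmeas[bv v1].
rewrite -[leRHS]mul1r -(bmeas_Rintegral_cst T_ge0).
by apply: bmeas_le_Rintegral => //; [exact: bmeas_norm|exact: bmeas_cst].
Qed.

(** On [[0, T]], [|v|] is bounded by the indicator of its closed support. *)
Lemma L1_le_L0 v : bounded_control T v ->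
  ((Int (fun s => `|v s|))%:E <= L0_norm T v)%E.
Proof.
move=> /bounded_control_bmeas[bv v1].
rewrite /L0_norm; set S := closure _.
have mS : measurable S by apply: closed_measurable; exact: closed_closure.
have le1 : Int (fun s => `|v s|) <= Int (\1_S).
  apply: bmeas_le_Rintegral; [exact: bmeas_norm|exact: bmeas_indic|].
  move=> s sT; rewrite indicE; have [v0|v0] := eqVneq (v s) 0.
    by rewrite v0 normr0.
  by rewrite mem_set/= ?v1//; apply: subset_closure.
apply: (@le_trans _ _ (Int (\1_S))%:E); first by rewrite lee_fin.
rewrite bmeas_Rintegral_indic// fineK.
  by apply: le_measure; rewrite ?inE//; exact: measurableI.
rewrite ge0_fin_numE//; apply: (@le_lt_trans _ _ (mu `[0%R, T]%classic)).
  by apply: le_measure; rewrite ?inE//; exact: measurableI.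
by rewrite mu_itv ltry.
Qed.

Lemma bmeas_bang h : continuous h -> bounded_measurable T (fun s => bang (h s)).
Proof.
move=> ch.
have := bmeas_indic T
  (open_measurable (open_comp (fun x _ => ch x) (@open_gt _ 1))).
have := bmeas_indic T
  (open_measurable (open_comp (fun x _ => ch x) (@open_lt _ (-1)))).
move=> /bmeasN b1 b2; have := bmeasD b2 b1; congr bounded_measurable.
apply/funext => s; rewrite !indicE /bang; congr (_%:R - _%:R).
- by congr nat_of_bool; apply/idP/idP; rewrite inE.
- by congr nat_of_bool; apply/idP/idP; rewrite inE.
Qed.

Lemma bounded_control_bang h : continuous h ->
  bounded_control T (fun s => bang (h s)).
Proof.
move=> ch; apply: bmeas_bounded_control; first exact: bmeas_bang.
by move=> s _; exact: norm_bang_le1.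
Qed.

(** Closing the support of the bang-off-bang control can add only points with [|h| = 1], which form
    a null set, while its L1 norm is the measure of the part of [[0, T]] where [|h| > 1]. *)
Lemma L0_bang_le h : continuous h -> mu [set s | h s = 1] = 0%E ->
  mu [set s | h s = -1] = 0%E ->
  (L0_norm T (fun s => bang (h s)) <= (Int (fun s => `|bang (h s)|))%:E)%E.
Proof.
move=> ch h1 hN1.
have mh c := measurable_level c ch.
pose S := [set s | 1 < `|h s|].
have cn : continuous (fun s => `|h s|) by move=> x; exact: cvg_norm (ch x).
have mS : measurable S.
  by apply: open_measurable; apply: open_comp (@open_gt _ 1) => x _; exact: cn.
have -> : Int (fun s => `|bang (h s)|) = Int (\1_S).
  apply: eq_Rintegral => s _; rewrite indicE.
  case: bangP => [h2|h2|h2 h3]; rewrite ?normr1 ?normrN1 ?normr0.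
  - by rewrite mem_set// /S/= (lt_le_trans h2)// ler_norm.
  - by rewrite mem_set// /S/= -normrN (lt_le_trans _ (ler_norm _))// ltrNr.
  - rewrite memNset// /S/= => hs; have : `|h s| <= 1 by rewrite ler_norml h2.
    by rewrite leNgt hs.
rewrite bmeas_Rintegral_indic// fineK; last first.
  rewrite ge0_fin_numE//; apply: (@le_lt_trans _ _ (mu `[0%R, T]%classic)).
    by apply: le_measure; rewrite ?inE//; exact: measurableI.
  by rewrite mu_itv ltry.
have mSD : measurable (S `&` `[0, T]%classic) by exact: measurableI.
apply: (@le_trans _ _ (mu ((S `&` `[0, T]%classic) `|`
    ([set s | h s = 1] `|` [set s | h s = -1])))).
  apply: le_measure; rewrite ?inE.
  - by apply: closed_measurable; exact: closed_closure.
  - by apply: measurableU; [exact: mSD|apply: measurableU; exact: mh].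
  apply: (@subset_trans _ ([set s | 1 <= `|h s|] `&` `[0, T]%classic)).
    apply: closure_supp_sub.
      apply: closedI; last exact: itv_closed.
      rewrite (_ : [set _ | _] = (fun s => `|h s|) @^-1` [set x | 1 <= x])//.
      by apply: closed_comp => [x _|]; [exact: cn|exact: closed_ge].
    move=> s sT; case: bangP => [h2|h2|h2 h3]; rewrite ?eqxx//; split => //=.
    - by rewrite (le_trans (ltW h2))// ler_norm.
    - by rewrite -normrN (le_trans _ (ler_norm _))// ltW// ltrNr.
  move=> s [/= hs sT]; move: hs; rewrite le_eqVlt => /orP[/eqP hs|hs]; last by left.
  right; move: hs; have [h0|h0] := leP 0 (h s).
    by rewrite ger0_norm// => <-; left.
  by rewrite ltr0_norm// => hs; right => /=; rewrite hs opprK.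
apply: (le_trans (measureU2 _ _ _)) => //; first by apply: measurableU; exact: mh.
rewrite -[leRHS]adde0 leeD2l//.
by rewrite le_eqVlt; apply/orP; left; apply/eqP; exact: null_setU.
Qed.

End L0_L1.

Lemma lip_continuous (R : realType) (V : normedModType R) (F : V -> R) (L : R) :
  (forall p q, F p - F q <= L * `|p - q|) -> continuous F.
Proof.
move=> FL p; apply/cvgrPdist_le => e e0.
have L1 : 0 < `|L| + 1 by rewrite ltr_wpDl.
apply/nbhs_normP; exists (e / (`|L| + 1)); first by rewrite /= divr_gt0.
move=> q /= /ltW pq.
have H : L * `|p - q| <= e.
  apply: (@le_trans _ _ ((`|L| + 1) * `|p - q|)).
    by rewrite ler_wpM2r// (le_trans (ler_norm _))// lerDl.
  by rewrite mulrC -ler_pdivlMr.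
rewrite ler_norml (le_trans (FL _ _))// andbT lerNl opprB.
by rewrite (le_trans (FL _ _))// distrC.
Qed.

(** * L1-optimal controls by duality *)

Section duality.
Variables (R : realType) (n : nat) (T : R) (A : 'M[R]_n) (B : 'cV[R]_n).
Hypothesis T_gt0 : 0 < T.
Hypotheses (AB_ctrl : controllable A B) (A_unit : A \in unitmx).
Notation mu := (@lebesgue_measure R).
Notation Int h := (\int[mu]_(s in `[0, T]) h s).
Notation g := (switching A B).
Implicit Types (p q : 'rV[R]_n) (x : 'cV[R]_n) (v w : R -> R).

Let T_ge0 : 0 <= T := ltW T_gt0.

Let bmeas_g p : bounded_measurable T (g p).
Proof. by apply: bmeas_continuous => //; exact: continuous_switching. Qed.

Let bmeas_lip (phi : R -> R) p : (forall y z : R, phi y - phi z <= `|y - z|) ->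
  bounded_measurable T (fun s => phi (g p s)).
Proof.
move=> phil; apply: bmeas_continuous => //.
have cphi : continuous phi.
  move=> y; apply/cvgrPdist_le => e e0; near=> z.
  apply: (@le_trans _ _ `|y - z|); last by near: z; exact: cvgr_dist_le.
  by rewrite ler_norml phil andbT lerNl opprB distrC phil.
move=> s; apply: continuous_comp; [exact: continuous_switching|exact: cphi].
Unshelve. all: by end_near. Qed.

Let bmeas_dead p : bounded_measurable T (fun s => dead_zone (g p s)).
Proof. by apply: bmeas_lip; exact: dead_zone_lip. Qed.

Let bmeas_bang_g p : bounded_measurable T (fun s => bang (g p s)).
Proof. by apply: bmeas_bang => //; exact: continuous_switching. Qed.

Let norm_lip (y z : R) : `|y| - `|z| <= `|y - z|.
Proof. exact: lerB_dist. Qed.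

Let le_sub4 (a b c d e f : R) :
  d - c <= e -> a - b <= f -> a - c - (b - d) <= e + f.
Proof. by move=> *; lra. Qed.

Lemma mul_input_control p v : bounded_control T v ->
  (p *m input_integral A B T v) 0 0 = Int (fun s => g p s * v s).
Proof. by move=> [vL1 _]; rewrite mul_input_integral. Qed.

Lemma switching0 s : g 0 s = 0.
Proof. by rewrite /switching !mul0mx mxE. Qed.

Lemma switchingB p q s : g (p - q) s = g p s - g q s.
Proof. by rewrite switchingD -scaleN1r switchingZ mulN1r. Qed.

(** For [p = 0] the level set is empty. This case matters because the dual maximiser can be 0. *)
Lemma unit_level_null p (c : R) : c != 0 -> mu [set s | g p s = c] = 0%E.
Proof.
move=> c0; have [->|p0] := eqVneq p 0; last exact: switching_level_null.
rewrite (_ : [set _ | _] = set0) ?measure0//.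
by apply/seteqP; split => s //=; rewrite switching0 => c0'; rewrite c0' eqxx in c0.
Qed.

Lemma dead_zone_level_null p : mu [set s | `|g p s| - 1 = 0] = 0%E.
Proof.
have mg c := measurable_level c (@continuous_switching _ _ A B p).
rewrite (_ : [set _ | _] = [set s | g p s = 1] `|` [set s | g p s = -1]).
  by apply: null_setU => //; rewrite unit_level_null ?oppr_eq0 ?oner_eq0.
apply/seteqP; split => s /=.
  move/eqP; rewrite subr_eq0 => /eqP.
  have [g0|g0] := leP 0 (g p s); first by rewrite ger0_norm// => ->; left.
  by rewrite ltr0_norm// => <-; right; rewrite opprK.
by case=> ->; rewrite ?normrN1 ?normr1 subrr.
Qed.

Lemma Int_lip_continuous (phi : R -> R) :
  (forall y z : R, phi y - phi z <= `|y - z|) ->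
  exists2 L : R, 0 <= L & forall p q,
  Int (fun s => phi (g p s)) - Int (fun s => phi (g q s)) <= L * `|p - q|.
Proof.
move=> phil; have [M M0 gM] := switching_bound A B T_ge0.
exists (M * T) => [|p q]; first by rewrite mulr_ge0// ltW.
rewrite -bmeas_RintegralB//; [|exact: bmeas_lip..].
rewrite mulrAC -(bmeas_Rintegral_cst T_ge0).
apply: bmeas_le_Rintegral; [|exact: bmeas_cst|].
  by apply: bmeasD; [|apply: bmeasN]; exact: bmeas_lip.
by move=> s sT; rewrite (le_trans (phil _ _))// -switchingB gM.
Qed.

Lemma mulmx_coord_le p x : (p *m x) 0 0 <= (\sum_i `|x i 0|) * `|p|.
Proof.
rewrite mxE mulr_suml ler_sum// => i _.
by rewrite (le_trans (ler_norm _))// normrM mulrC ler_wpM2l// le_coord_norm.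
Qed.

Lemma mul_rowBl_entry p q x :
  ((p - q) *m x) 0 0 = (p *m x) 0 0 - (q *m x) 0 0.
Proof. by rewrite mulmxBl !mxE. Qed.

Lemma mul_rowBr_entry p x x' :
  (p *m (x - x')) 0 0 = (p *m x) 0 0 - (p *m x') 0 0.
Proof. by rewrite mulmxBr !mxE. Qed.

Lemma mul_rowDZ_entry p q a x :
  ((p + a *: q) *m x) 0 0 = (p *m x) 0 0 + a * (q *m x) 0 0.
Proof. by rewrite mulmxDl -scalemxAl !mxE. Qed.

(* The maximised function is the Lagrange dual of L1-minimisation: the infimum
   over |y| <= 1 of |y| - c y is [- dead_zone c], attained at [bang c]. *)
Lemma first_order_condition x p :
  (forall q, (q *m x) 0 0 - Int (fun s => dead_zone (g q s))
     <= (p *m x) 0 0 - Int (fun s => dead_zone (g p s))) ->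
  input_integral A B T (fun s => bang (g p s)) = x.
Proof.
move=> pmax; set v := fun s => _; set y := input_integral A B T v.
have bv : bounded_control T v.
  by apply: bounded_control_bang => //; exact: continuous_switching.
(* The residual as direction of variation: [q (x - y)] is its squared Euclidean norm, so the upper
   bound 0 forces [x = y]. *)
pose q := (x - y)^T.
suff : (q *m (x - y)) 0 0 <= 0.
  rewrite mxE => qxy.
  have : \sum_j q 0 j * (x - y) j 0 == 0.
    rewrite eq_le qxy sumr_ge0// => i _.
    by rewrite [q 0 i]mxE -expr2 sqr_ge0.
  rewrite psumr_eq0 => [/allP q0|i _]; last by rewrite [q 0 i]mxE -expr2 sqr_ge0.
  apply/eqP; rewrite eq_sym -subr_eq0; apply/eqP/colP => i.
  have := q0 i (mem_index_enum _); rewrite [q 0 i]mxE mulf_eq0 orbb => /eqP ->.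
  by rewrite mxE.
have [M M0 gM] := switching_bound A B T_ge0.
pose m := M * `|q|; have m0 : 0 <= m by rewrite mulr_ge0// ltW.
apply/ler_addgt0Pr => e e0; rewrite add0r.
have ch : continuous (fun s => `|g p s| - 1).
  move=> s; apply: cvgB; last exact: cvg_cst.
  by apply: cvg_norm; exact: continuous_switching.
(* Makes the final error [2 * m * Int (\1_S)] at most [e]; [m + 1] stands in for [m], which may be
   0. *)
have e1 : 0 < e / (2 * (m + 1)) by rewrite divr_gt0// mulr_gt0// ltr_wpDl.
have [d d0 hd] := small_sublevel T ch (dead_zone_level_null p) e1.
set S := [set s | `| `|g p s| - 1| <= d] in hd.
have mS : measurable S by apply: closed_measurable; exact: closed_sublevel.
(* A step so short that [|t * g q s| <= d], so that the error set of [dead_zone_variation] lies in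
   [S]. *)
pose t := d / (m + 1).
have t0 : 0 < t by rewrite divr_gt0// ltr_wpDl.
have tm : t * (m + 1) = d by rewrite /t divfK// gt_eqF// ltr_wpDl.
have tmd : t * m <= d by rewrite -tm ler_wpM2l ?(ltW t0)// lerDl.
have var : Int (fun s => dead_zone (g (p + t *: q) s))
    - Int (fun s => dead_zone (g p s))
    <= t * (q *m y) 0 0 + 2 * (t * m) * Int (\1_S).
  have b1 : bounded_measurable T (fun s => g q s * v s).
    exact: bmeasM (bmeas_g q) (bmeas_bang_g p).
  have b2 : bounded_measurable T (fun s => t * (g q s * v s)).
    by apply: bmeasM => //; exact: bmeas_cst.
  have bS : bounded_measurable T \1_S by exact: bmeas_indic.
  have b3 : bounded_measurable T (fun s => 2 * (t * m) * \1_S s).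
    by apply: bmeasM => //; exact: bmeas_cst.
  rewrite mul_input_control// -(bmeas_RintegralZ t b1).
  rewrite -(bmeas_RintegralZ (2 * (t * m)) bS).
  rewrite -bmeas_RintegralB// -bmeas_RintegralD//.
  apply: bmeas_le_Rintegral; [|exact: bmeasD|].
    by apply: bmeasD => //; exact: bmeasN.
  move=> s sT; rewrite switchingD switchingZ.
  have dm : `|t * g q s| <= t * m by rewrite normrM gtr0_norm// ler_pM2l// gM.
  apply: (le_trans (dead_zone_variation _ dm)).
  rewrite [t * (_ * _)]mulrA; apply: lerD => //; apply: ler_wpM2l.
    by rewrite mulr_ge0// mulr_ge0// ltW.
  rewrite indicE ler_nat; case: (boolP (_ <= t * m)) => // h.
  by rewrite mem_set// /S/= (le_trans h).
(* Optimality of [p] against [p + t q] bounds [t * (q x)] by the variation; dividing by [t] leaves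
   only the error term. *)
have := pmax (p + t *: q); rewrite mul_rowDZ_entry.
rewrite mul_rowBr_entry => opt.
have : t * ((q *m x) 0 0 - (q *m y) 0 0) <= t * (2 * m * Int (\1_S)) by nra.
rewrite ler_pM2l// => /le_trans; apply.
apply: (@le_trans _ _ (2 * (m + 1) * (e / (2 * (m + 1))))).
  apply: ler_pM => //; first by rewrite mulr_ge0.
    by apply: Rintegral_ge0 => s _; rewrite indicE.
  by rewrite ler_pM2l// lerDl.
by rewrite mulrC divfK// gt_eqF// mulr_gt0// ltr_wpDl.
Qed.

(** With [L1_le_L0] the third condition makes both norms of [v] equal, so that L1-minimality entails
    L0-minimality. *)
Definition L1_optimal x v : Prop :=
  [/\ bounded_control T v, input_integral A B T v = x,
      (L0_norm T v <= (Int (fun s => `|v s|))%:E)%E &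
      forall w, bounded_control T w -> input_integral A B T w = x ->
        Int (fun s => `|v s|) <= Int (fun s => `|w s|)].

(** Both controls have the same pairing with [p]. Subtracting it from the two L1 norms reduces the
    claim to the pointwise [bang_minimizes]. *)
Lemma bang_L1_optimal x p :
  input_integral A B T (fun s => bang (g p s)) = x ->
  L1_optimal x (fun s => bang (g p s)).
Proof.
move=> vx; have cg := @continuous_switching _ _ A B p.
have bv := bounded_control_bang T cg.
split => //.
  by apply: L0_bang_le; rewrite ?unit_level_null ?oppr_eq0 ?oner_eq0.
move=> w bw wx.
have := congr1 (fun z => (p *m z) 0 0) (etrans vx (esym wx)).
rewrite /= !mul_input_control// => vw.
have [mw w1] := bounded_control_bmeas bw.
rewrite -(lerD2r (- Int (fun s => g p s * bang (g p s)))) [in leRHS]vw.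
rewrite -!bmeas_RintegralB//; do ?[exact: bmeas_norm|exact: bmeasM].
apply: bmeas_le_Rintegral.
- by apply: bmeasD; [exact: bmeas_norm|apply: bmeasN; exact: bmeasM].
- by apply: bmeasD; [exact: bmeas_norm|apply: bmeasN; exact: bmeasM].
- by move=> s sT; apply: bang_minimizes; exact: w1.
Qed.

(** As [dead_zone y >= |y| - 1], the dual function is at most [T - d * |p|]. Beyond radius [T / d]
    it is thus at most 0, its value at 0, and a maximiser over this compact ball is global. *)
Lemma coercive_optimal x (d : R) : 0 < d ->
  (forall p, (p *m x) 0 0 + d * `|p| <= Int (fun s => `|g p s|)) ->
  exists v, L1_optimal x v.
Proof.
move=> d0 hd.
pose D p := (p *m x) 0 0 - Int (fun s => dead_zone (g p s)).
have D0 : D 0 = 0.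
  rewrite /D mul0mx mxE add0r; apply/eqP; rewrite oppr_eq0; apply/eqP.
  under eq_Rintegral do rewrite switching0.
  by rewrite bmeas_Rintegral_cst// /dead_zone normr0 sub0r max_r ?mul0r// lerN10.
have Dle p : D p <= T - d * `|p|.
  have : Int (fun s => `|g p s| - 1) <= Int (fun s => dead_zone (g p s)).
    apply: bmeas_le_Rintegral => //.
      by apply: bmeasD; [exact: bmeas_norm|exact: bmeas_cst].
    by move=> s _; exact: dead_zone_ge.
  rewrite bmeas_RintegralB//; [|exact: bmeas_norm|exact: bmeas_cst].
  rewrite bmeas_Rintegral_cst// mul1r /D; have := hd p; lra.
have [L L0 DL] := Int_lip_continuous (@dead_zone_lip R).
have cD : continuous D.
  apply: (@lip_continuous _ _ _ (\sum_i `|x i 0| + L)) => p q; rewrite /D mulrDl.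
  have := DL q p; rewrite distrC; have := mulmx_coord_le (p - q) x.
  rewrite mul_rowBl_entry; lra.
pose K : set 'rV[R]_n := [set p | `|p| <= T / d].
have [p /set_mem pK pmax] : exists2 p, p \in K & forall q, q \in K -> D q <= D p.
  apply: EVT_max_rV; last exact: continuous_subspaceT.
    by exists 0; rewrite /K/= normr0 divr_ge0// ltW.
  apply: bounded_closed_compact.
    exists (T / d); split; first exact: num_real.
    by move=> r Tr q /= qK; rewrite (le_trans qK)// ltW.
  rewrite (_ : K = (fun q => `|q|) @^-1` [set r | r <= T / d])//.
  by apply: closed_comp => [q _|]; [exact: norm_continuous|exact: closed_le].
exists (fun s => bang (g p s)); apply/bang_L1_optimal/first_order_condition => q.
have [qK|qK] := leP `|q| (T / d); first exact/pmax/mem_set.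
apply: (@le_trans _ _ 0).
  by apply: (le_trans (Dle q)); rewrite subr_le0 mulrC -ler_pdivrMr// ltW.
by move: (pmax 0); rewrite D0; apply; rewrite mem_set// /K/= normr0 divr_ge0// ltW.
Qed.

(** The gap between the two sides is continuous and positively homogeneous in [p]; its minimum over
    the compact unit sphere, nonempty as [0 < n], serves as [d]. *)
Lemma strict_support_coercive x : (0 < n)%N ->
  (forall p, p != 0 -> (p *m x) 0 0 < Int (fun s => `|g p s|)) ->
  exists2 d : R, 0 < d &
    forall p, (p *m x) 0 0 + d * `|p| <= Int (fun s => `|g p s|).
Proof.
move=> n_gt0 hx.
pose k p := Int (fun s => `|g p s|) - (p *m x) 0 0.
have [L L0 kL] := Int_lip_continuous norm_lip.
have ck : continuous k.
  apply: (@lip_continuous _ _ _ (\sum_i `|x i 0| + L)) => p q; rewrite /k mulrDl.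
  have := kL p q; have := mulmx_coord_le (q - p) x; rewrite (distrC q p).
  by rewrite mul_rowBl_entry; exact: le_sub4.
have kZ a p : 0 <= a -> k (a *: p) = a * k p.
  move=> a0; rewrite /k.
  have -> : ((a *: p) *m x) 0 0 = a * (p *m x) 0 0 by rewrite -scalemxAl mxE.
  rewrite mulrBr; congr (_ - _).
  rewrite -bmeas_RintegralZ//; last exact: bmeas_norm.
  by apply: eq_Rintegral => s _; rewrite switchingZ normrM ger0_norm.
have normed p : p != 0 -> `|(`|p|^-1 *: p)| = 1.
  move=> p0; rewrite normrZ normfV normr_id mulVf// normr_eq0//.
pose K : set 'rV[R]_n := [set p | `|p| = 1].
have [p /set_mem pK pmin] : exists2 p, p \in K & forall q, q \in K -> k p <= k q.
  apply: EVT_min_rV; last exact: continuous_subspaceT.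
    exists (`|const_mx 1 : 'rV[R]_n|^-1 *: const_mx 1); apply: normed.
    apply/eqP => /rowP/(_ (Ordinal n_gt0)); rewrite !mxE => /eqP.
    by rewrite oner_eq0.
  apply: bounded_closed_compact.
    exists 1; split; first exact: num_real.
    by move=> r r1 q /= ->; rewrite ltW.
  rewrite (_ : K = (fun q => `|q|) @^-1` [set 1])//.
  by apply: closed_comp => [q _|]; [exact: norm_continuous|exact: closed_eq].
exists (k p).
  by rewrite subr_gt0 hx// -normr_gt0 pK.
move=> q; have [->|q0] := eqVneq q 0.
  rewrite normr0 mulr0 addr0 mul0mx mxE; apply: Rintegral_ge0 => s _.
  exact: normr_ge0.
have q1 : q = `|q| *: (`|q|^-1 *: q) by rewrite scalerA divff ?normr_eq0// scale1r.
have : k p * `|q| <= k q.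
  rewrite [in leRHS]q1 kZ// mulrC ler_wpM2l// pmin//; apply/mem_set.
  exact: normed.
by rewrite [leRHS]/k lerBrDl.
Qed.

(** [J = |g p| - g p * v] dominates [|g p| * (1 - |v|)]. Hence [1 - |v|] is at most [J] over a
    threshold where [|g p|] exceeds that threshold, and at most 1 on the small set where it does
    not; each part contributes at most [e / 2]. *)
Lemma support_L1_norm p (e : R) : p != 0 -> 0 < e -> exists2 d : R, 0 < d &
  forall v, bounded_control T v ->
    Int (fun s => `|g p s|) - (p *m input_integral A B T v) 0 0 <= d ->
    T - e <= Int (fun s => `|v s|).
Proof.
move=> p0 e0; have e20 : 0 < e / 2 by rewrite divr_gt0.
have [d d0 hd] := small_sublevel T (@continuous_switching _ _ A B p)
  (switching_level_null 0 AB_ctrl A_unit p0) e20.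
set S := [set s | `|g p s| <= d] in hd.
have mS : measurable S.
  by apply: closed_measurable; apply: closed_sublevel; exact: continuous_switching.
exists (d * (e / 2)); first by rewrite mulr_gt0.
move=> v bv; have [mv v1] := bounded_control_bmeas bv.
rewrite mul_input_control// -bmeas_RintegralB//; [|exact: bmeas_norm|exact: bmeasM].
set J := fun s => _ - _; move=> hJ.
have bJ : bounded_measurable T J.
  by apply: bmeasD; [exact: bmeas_norm|apply: bmeasN; exact: bmeasM].
have : Int (fun s => 1 - `|v s|) <= Int (fun s => \1_S s + d^-1 * J s).
  apply: bmeas_le_Rintegral.
  - by apply: bmeasD; [exact: bmeas_cst|apply: bmeasN; exact: bmeas_norm].
  - by apply: bmeasD; [exact: bmeas_indic|apply: bmeasM => //; exact: bmeas_cst].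
  move=> s sT; have vs1 := v1 s sT.
  have Jge : `|g p s| * (1 - `|v s|) <= J s.
    by rewrite mulrBr mulr1 lerD2l lerN2 -normrM ler_norm.
  have v10 : 0 <= 1 - `|v s| by rewrite subr_ge0.
  rewrite indicE; have [gs|gs] := leP `|g p s| d.
    rewrite mem_set// -[leLHS]addr0 lerD//.
      by rewrite gerDl oppr_le0.
    by rewrite mulr_ge0 ?invr_ge0 ?(ltW d0)// (le_trans _ Jge)// mulr_ge0.
  rewrite memNset/= ?add0r; last by apply/negP; rewrite -ltNge.
  rewrite ler_pdivlMl// (le_trans _ Jge)// ler_wpM2r// ltW//.
rewrite bmeas_RintegralB//; [|exact: bmeas_cst|exact: bmeas_norm].
rewrite bmeas_Rintegral_cst// mul1r.
rewrite bmeas_RintegralD//; first last.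
- by apply: bmeasM => //; exact: bmeas_cst.
- exact: bmeas_indic.
rewrite bmeas_RintegralZ//.
have : d^-1 * Int J <= e / 2 by rewrite ler_pdivrMl.
lra.
Qed.

Lemma reachable_L1_optimal x : (0 < n)%N ->
  reachable_set A B T x -> exists v, L1_optimal x v.
Proof.
move=> n_gt0 [v bv vx].
have [hx|] := pselect (forall p, p != 0 -> (p *m x) 0 0 < Int (fun s => `|g p s|)).
  by have [d d0 hd] := strict_support_coercive n_gt0 hx; exact: coercive_optimal hd.
move=> /existsNP[p /not_implyP[p0 /negP]]; rewrite -leNgt => px.
(* The deficit [h(p) - p x] is at most 0, hence below every threshold of [support_L1_norm]; so the
   given [v] is itself optimal. *)
have full w : bounded_control T w -> input_integral A B T w = x ->
    T <= Int (fun s => `|w s|).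
  move=> bw wx; apply/ler_addgt0Pr => e e0; rewrite -lerBlDr.
  have [d d0 hd] := support_L1_norm p0 e0.
  by apply: hd => //; rewrite wx (le_trans _ (ltW d0))// subr_le0.
exists v; split => //.
  by apply: (le_trans (L0_norm_le T_ge0 v)); rewrite lee_fin full.
by move=> w bw wx; rewrite (le_trans _ (full w bw wx))// L1_le_T.
Qed.

End duality.

(** * The value function *)

Lemma within_continuous_dist (R : realType) (V : normedModType R) (S : set V)
    (F : V -> R) :
  (forall x, S x -> forall e, 0 < e -> exists2 r, 0 < r &
     forall y, S y -> `|x - y| < r -> `|F x - F y| <= e) ->
  {within S, continuous F}.
Proof.
move=> SF; apply/subspace_continuousP => x Sx; apply/cvgrPdist_le => e e0.
have [r r0 xr] := SF x Sx e e0.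
rewrite near_withinE; apply/nbhs_normP; exists r => // y /= xy Sy.
exact: xr.
Qed.

Section value_function_theory.
Variables (R : realType) (n : nat) (T : R) (A : 'M[R]_n) (B : 'cV[R]_n).
Hypotheses (n_gt0 : (0 < n)%N) (T_gt0 : 0 < T).
Hypotheses (AB_ctrl : controllable A B) (A_unit : A \in unitmx).
Notation mu := (@lebesgue_measure R).
Notation Int h := (\int[mu]_(s in `[0, T]) h s).
Notation g := (switching A B).
Notation reach := (reachable_set A B T).
Notation V := (value_function A B T).
Implicit Types (p q : 'rV[R]_n) (x xi : 'cV[R]_n) (v w : R -> R).

Let T_ge0 : 0 <= T := ltW T_gt0.

Lemma bounded_control_comb (a b : R) v w : `|a| + `|b| <= 1 ->
  bounded_control T v -> bounded_control T w ->
  bounded_control T (fun s => a * v s + b * w s).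
Proof.
move=> ab /bounded_control_bmeas[bv v1] /bounded_control_bmeas[bw w1].
apply: bmeas_bounded_control => //.
  by apply: bmeasD; apply: bmeasM => //; exact: bmeas_cst.
move=> s sT; rewrite (le_trans (ler_normD _ _))// (le_trans _ ab)// lerD//.
  by rewrite normrM ler_piMr// v1.
by rewrite normrM ler_piMr// w1.
Qed.

Lemma input_integral_comb (a b : R) v w :
  bounded_control T v -> bounded_control T w ->
  input_integral A B T (fun s => a * v s + b * w s)
  = a *: input_integral A B T v + b *: input_integral A B T w.
Proof.
move=> /bounded_control_bmeas[bv _] /bounded_control_bmeas[bw _].
apply/colP => i; rewrite !mxE.
have bgv u : bounded_measurable T u ->
    bounded_measurable T (fun s => (expmx (- (s *: A)) *m B) i 0 * u s).
  move=> bu; apply: bmeasM => //; apply: bmeas_continuous => //.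
  under [X in continuous X]eq_fun do rewrite input_entryE.
  exact: continuous_switching.
have bgv' c u : bounded_measurable T u ->
    bounded_measurable T (fun s => c * ((expmx (- (s *: A)) *m B) i 0 * u s)).
  by move=> bu; apply: bmeasM; [exact: bmeas_cst|exact: bgv].
rewrite -(bmeas_RintegralZ a (bgv _ bv)) -(bmeas_RintegralZ b (bgv _ bw)).
rewrite -(bmeas_RintegralD (bgv' a _ bv) (bgv' b _ bw)).
by apply: eq_Rintegral => s _; ring.
Qed.

(** Admissible controls for [xi] have integral [- xi], whereas the reachable set collects the
    integrals themselves; the symmetric bound on controls reconciles the signs. *)
Lemma reachableN xi : reach xi -> reach (- xi).
Proof.
move=> [v bv <-]; exists (fun s => -1 * v s + 0 * v s).
  by apply: bounded_control_comb => //; rewrite normrN1 normr0 addr0.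
by rewrite input_integral_comb// scaleN1r scale0r addr0.
Qed.

(** For admissible [w], the L1 norm of [v] is at most that of [w], hence at most the L0 norm of [w];
    and the two norms of [v] coincide. *)
Lemma L1_optimal_value xi v : L1_optimal T A B (- xi) v ->
  [/\ admissible A B T xi v, L0_norm T v = (V xi)%:E &
      V xi = Int (fun s => `|v s|)].
Proof.
move=> [bv vx L0v vmin].
have L0E : L0_norm T v = (Int (fun s => `|v s|))%:E.
  by apply/eqP; rewrite eq_le L0v L1_le_L0.
have av : admissible A B T xi v by [].
suff VE : V xi = Int (fun s => `|v s|) by split; rewrite ?VE.
rewrite /value_function (_ : ereal_inf _ = (Int (fun s => `|v s|))%:E)//.
apply/eqP; rewrite eq_le; apply/andP; split.
  by rewrite -L0E; apply: ereal_inf_lbound; exists v.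
apply: le_ereal_inf_tmp => _ [w [bw wx] <-].
by apply: (le_trans _ (L1_le_L0 T_ge0 bw)); rewrite lee_fin vmin.
Qed.

Lemma value_attained xi : reach xi -> exists v,
  [/\ admissible A B T xi v, L0_norm T v = (V xi)%:E &
      V xi = Int (fun s => `|v s|)].
Proof.
move=> /reachableN Rxi.
have [v vopt] := reachable_L1_optimal T_gt0 AB_ctrl A_unit n_gt0 Rxi.
by exists v; exact: L1_optimal_value.
Qed.

(** Having the L1 norm on the right, not the larger L0 norm, is the point: it is convex in the
    control, whence the convexity of [V]. *)
Lemma value_le_L1 xi w : admissible A B T xi w -> V xi <= Int (fun s => `|w s|).
Proof.
move=> [bw wx]; have Rxi : reach (- xi) by exists w.
have [v vopt] := reachable_L1_optimal T_gt0 AB_ctrl A_unit n_gt0 Rxi.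
have [_ _ ->] := L1_optimal_value vopt.
by case: vopt => _ _ _; exact.
Qed.

Lemma value_bounds xi : reach xi -> 0 <= V xi <= T.
Proof.
move=> /value_attained[v [[bv _] _ ->]]; rewrite L1_le_T// andbT.
by apply: Rintegral_ge0 => s _; exact: normr_ge0.
Qed.

Lemma value_convex (t : R) x y z : 0 <= t <= 1 -> reach x -> reach y ->
  z = (1 - t) *: x + t *: y -> V z <= (1 - t) * V x + t * V y.
Proof.
move=> /andP[t0 t1] /value_attained[v [[bv vx] _ ->]].
move=> /value_attained[w [[bw wy] _ ->]] zE.
have t10 : 0 <= 1 - t by rewrite subr_ge0.
have [mv _] := bounded_control_bmeas bv.
have [mw _] := bounded_control_bmeas bw.
have az : admissible A B T z (fun s => (1 - t) * v s + t * w s).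
  split; first by apply: bounded_control_comb => //; rewrite !ger0_norm// subrK.
  by rewrite input_integral_comb// vx wy !scalerN -opprD zE.
have nv := bmeas_norm mv; have nw := bmeas_norm mw.
have nvt : bounded_measurable T (fun s => (1 - t) * `|v s|).
  by apply: bmeasM => //; exact: bmeas_cst.
have nwt : bounded_measurable T (fun s => t * `|w s|).
  by apply: bmeasM => //; exact: bmeas_cst.
apply: (le_trans (value_le_L1 az)).
rewrite -(bmeas_RintegralZ (1 - t) nv) -(bmeas_RintegralZ t nw).
rewrite -bmeas_RintegralD//; apply: bmeas_le_Rintegral; last first.
- move=> s _; rewrite (le_trans (ler_normD _ _))// !normrM.
  by rewrite (ger0_norm t0) (ger0_norm t10).
- exact: bmeasD.
- by apply: bmeas_norm; apply: bmeasD; apply: bmeasM => //; exact: bmeas_cst.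
Qed.

(** Vectors carry the maximum norm, whence the factor [n]. *)
Lemma mulmx_entry_le p x : (p *m x) 0 0 <= n%:R * `|x| * `|p|.
Proof.
rewrite (le_trans (mulmx_coord_le p x))// ler_wpM2r//.
apply: (@le_trans _ _ (\sum_(i < n) `|x|)).
  by apply: ler_sum => i _; exact: le_coord_norm.
by rewrite sumr_const card_ord -[leLHS]mulr_natl.
Qed.

(* Here [- xi] lies on the boundary of the reachable set, with outer normal p. *)
Lemma value_continuous_boundary xi p : reach xi -> p != 0 ->
  Int (fun s => `|g p s|) <= (p *m - xi) 0 0 ->
  forall e, 0 < e -> exists2 r, 0 < r &
    forall y, reach y -> `|xi - y| < r -> `|V xi - V y| <= e.
Proof.
move=> Rxi p0 pxi e e0.
have [d d0 hd] := support_L1_norm T_gt0 AB_ctrl A_unit p0 e0.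
have c0 : 0 < n%:R * `|p| by rewrite mulr_gt0 ?ltr0n ?normr_gt0.
(* Within this radius the pairing with [p] moves by at most [d], so a control for [y] misses the
   support value [h(p)] by at most [d]. *)
have near_full y : reach y -> `|xi - y| <= d / (n%:R * `|p|) -> T - e <= V y.
  move=> /value_attained[w [[bw wy] _ ->]] xiy; apply: hd => //.
  rewrite wy (le_trans (lerB pxi (lexx _)))// -mul_rowBr_entry opprK addrC.
  rewrite (le_trans (mulmx_entry_le _ _))// mulrAC mulrC -ler_pdivlMr//.
  by rewrite distrC.
exists (d / (n%:R * `|p|)); first by rewrite divr_gt0.
move=> y Ry /ltW /(near_full y Ry) Ty.
have Txi : T - e <= V xi.
  by apply: near_full => //; rewrite subrr normr0 divr_ge0// ltW.
have /andP[_ VxiT] := value_bounds Rxi; have /andP[_ VyT] := value_bounds Ry.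
by rewrite ler_norml; apply/andP; split; lra.
Qed.

(** Replacing [xi] by [y] costs at most half of the coercivity margin; the remaining half still
    yields a dual maximiser, hence a control for [y]. *)
Lemma coercive_ball_reachable xi (d : R) : 0 < d ->
  (forall p, (p *m - xi) 0 0 + d * `|p| <= Int (fun s => `|g p s|)) ->
  exists2 r, 0 < r & forall y, `|xi - y| <= r -> reach y.
Proof.
move=> d0 hd; have n0 : 0 < n%:R :> R by rewrite ltr0n.
exists (d / 2 / n%:R); first by rewrite !divr_gt0.
move=> y xiy; suff : reach (- y) by move/reachableN; rewrite opprK.
have d20 : 0 < d / 2 by rewrite divr_gt0.
suff hy p : (p *m - y) 0 0 + d / 2 * `|p| <= Int (fun s => `|g p s|).
  have [v [bv vy _ _]] := coercive_optimal T_gt0 AB_ctrl A_unit d20 hy.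
  by exists v.
have hxi := hd p; have hxiy := mulmx_entry_le p (xi - y).
have H : n%:R * `|xi - y| * `|p| <= d / 2 * `|p|.
  by rewrite ler_wpM2r// mulrC -ler_pdivlMr.
rewrite mul_rowBr_entry in hxiy.
rewrite mulmxN mxE in hxi; rewrite mulmxN mxE.
move: hxi hxiy H; lra.
Qed.

(** Convexity and [0 <= V <= T] are used twice: [y] lies between [xi] and a point of the ball beyond
    [y], and [xi] between [y] and the opposite point of the ball. *)
Lemma value_continuous_interior xi (r : R) : reach xi -> 0 < r ->
  (forall y, `|xi - y| <= r -> reach y) ->
  forall e, 0 < e -> exists2 r', 0 < r' &
    forall y, reach y -> `|xi - y| < r' -> `|V xi - V y| <= e.
Proof.
move=> Rxi r0 hr e e0; pose t := e / (T + e).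
have Te : 0 < T + e by rewrite addr_gt0.
have t0 : 0 < t by rewrite divr_gt0.
have tT : t * T <= e.
  by rewrite /t mulrAC ler_pdivrMr// ler_pM2l// lerDl ltW.
have t1 : t <= 1 by rewrite /t ler_pdivrMr// mul1r lerDr ltW.
exists (t * r); first by rewrite mulr_gt0.
move=> y Ry /ltW xiy.
have dist_t : `|t^-1 *: (xi - y)| <= r.
  by rewrite normrZ gtr0_norm ?invr_gt0// mulrC ler_pdivrMr// mulrC.
have Rz : reach (xi - t^-1 *: (xi - y)) by apply: hr; rewrite opprB addrC subrK.
have Rw : reach (xi + t^-1 *: (xi - y)).
  by apply: hr; rewrite opprD addrA subrr add0r normrN.
have tn0 : t != 0 by rewrite gt_eqF.
have t1n0 : 1 + t != 0 by rewrite gt_eqF// addr_gt0.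
have yE : y = (1 - t) *: xi + t *: (xi - t^-1 *: (xi - y)).
  by apply/colP => i; rewrite !mxE; field.
(* [xi] divides the segment from [y] to the opposite point in the ratio [t : 1]. *)
pose s := t / (1 + t).
have s01 : 0 <= s <= 1.
  by rewrite divr_ge0 ?addr_ge0 ?(ltW t0)//= ler_pdivrMr ?mul1r ?lerDr ?addr_gt0.
have st : s <= t.
  by rewrite ler_pdivrMr ?addr_gt0// ler_peMr ?(ltW t0)// lerDl ltW.
have xiE : xi = (1 - s) *: y + s *: (xi + t^-1 *: (xi - y)).
  by apply/colP => i; rewrite !mxE /s; field; rewrite tn0.
have t01 : 0 <= t <= 1 by rewrite (ltW t0).
have le1 := value_convex t01 Rxi Rz yE.
have le2 := value_convex s01 Ry Rw xiE.
have /andP[V1 V1'] := value_bounds Rxi; have /andP[V2 V2'] := value_bounds Ry.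
have /andP[V3 V3'] := value_bounds Rz; have /andP[V4 V4'] := value_bounds Rw.
have /andP[s0 s1] := s01.
have H1 : t * V (xi - t^-1 *: (xi - y)) <= t * T by rewrite ler_pM2l.
have H2 : s * V (xi + t^-1 *: (xi - y)) <= t * T.
  by rewrite ler_pM.
(* Nonnegativity of [V] lets the factors [1 - t] and [1 - s] be replaced by 1. *)
have H3 : 0 <= t * V xi by rewrite mulr_ge0// ltW.
have H4 : 0 <= s * V y by rewrite mulr_ge0.
by rewrite ler_norml; apply/andP; split; lra.
Qed.

Lemma value_continuous xi : reach xi -> forall e, 0 < e -> exists2 r, 0 < r &
  forall y, reach y -> `|xi - y| < r -> `|V xi - V y| <= e.
Proof.
move=> Rxi.
have [hx|] := pselect (forall p, p != 0 ->
    (p *m - xi) 0 0 < Int (fun s => `|g p s|)).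
  have [d d0 hd] := strict_support_coercive T_gt0 n_gt0 hx.
  have [r r0 hr] := coercive_ball_reachable d0 hd.
  exact: (value_continuous_interior Rxi r0 hr).
move=> /existsNP[p /not_implyP[p0 /negP]]; rewrite -leNgt => px.
exact: (value_continuous_boundary Rxi p0 px).
Qed.

End value_function_theory.

Theorem theorem5 (R : realType) (n : nat) (T : R) (A : 'M[R]_n) (B : 'cV[R]_n)
  (n_gt0 : (0 < n)%N) (T_gt0 : 0 < T)
  (AB_ctrl : controllable A B) (A_nonsing : A \in unitmx) :
  (* the minimum defining V is attained on the reachable set *)
  (forall xi : 'cV[R]_n, reachable_set A B T xi ->
     exists2 u : R -> R, admissible A B T xi u
                       & L0_norm T u = (value_function A B T xi)%:E) /\
  {within reachable_set A B T, continuous (value_function A B T)}.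
Proof.
split.
  move=> xi Rxi.
  have [v [av vV _]] := value_attained n_gt0 T_gt0 AB_ctrl A_nonsing Rxi.
  by exists v.
by apply: within_continuous_dist => xi Rxi; exact: value_continuous.
Qed.
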